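(* Let $b$ be a function with domain $\omega$ with $b(i)\neq\emptyset$ for all $i$, and $h\in\omega^\omega$ with $h\geq^*1$ and $h(i)<|b(i)|$ for all but finitely many $i$. If the sequence $\langle h(i)/|b(i)|:i<\omega\rangle$ does not converge to $0$ (where $h(i)/|b(i)|:=0$ when $b(i)$ is infinite), then $\mathfrak{b}^{\mathrm{aLc}}_{b,h}=N$, where $N$ is the least natural number such that $B_N:=\{i<\omega:|b(i)|\leq N\cdot h(i)\}$ is infinite, and $\mathfrak{d}^{\mathrm{aLc}}_{b,h}=\mathfrak{c}$.
   Context: $\prod b=\prod_i b(i)$; $\mathcal{S}(b,h)=\prod_i[b(i)]^{\leq h(i)}$; $\varphi\not\ni^* x$ means $x(i)\notin\varphi(i)$ for all but finitely many $i$. $\mathfrak{b}^{\mathrm{aLc}}_{b,h}$ is the least size of an $F\subseteq\mathcal{S}(b,h)$ such that no $x\in\prod b$ satisfies $\varphi\not\ni^*x$ for all $\varphi\in F$; $\mathfrak{d}^{\mathrm{aLc}}_{b,h}$ is the least size of a $D\subseteq\prod b$ such that for every $\varphi\in\mathcal{S}(b,h)$ there is $x\in D$ with $\varphi\not\ni^*x$. $\mathfrak{c}=2^{\aleph_0}$. *)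

(* Defs.v *)
From HB Require Import structures.
From mathcomp Require Import all_boot all_order all_algebra.
From mathcomp Require Import finmap.
From mathcomp Require Import all_classical all_reals all_analysis.

Set Implicit Arguments.
Unset Strict Implicit.
Unset Printing Implicit Defensive.

Import Order.TTheory GRing.Theory Num.Theory.
Import numFieldNormedType.Exports.

Local Open Scope classical_set_scope.
Local Open Scope card_scope.
Local Open Scope ring_scope.

(* Cardinals are represented by sets considered up to equipotence [#=];
   the natural number n is the cardinal of `I_n = {k | k < n}. *)
Definition card_lt (U V : Type) (A : set U) (B : set V) : bool :=
  (A #<= B) && ~~ (B #<= A).

(* "The least size of a set A satisfying P exists and equals |K|." *)
Definition least_size (U V : Type) (P : set (set U)) (K : set V) : Prop :=
  (exists2 A, P A & A #= K) /\ (forall A, P A -> K #<= A).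

Definition continuum : set (nat -> bool) := [set: nat -> bool].

Section AntiLocalization.
Context {T : choiceType}.
Implicit Types (b : nat -> set T) (h : nat -> nat).

Definition prodset b : set (nat -> T) := [set x | forall i, b i (x i)].

Definition slaloms b h : set (nat -> set T) :=
  [set phi | forall i, phi i `<=` b i /\ phi i #<= `I_(h i)].

(* phi \not\ni^* x *)
Definition evt_avoids (phi : nat -> set T) (x : nat -> T) : Prop :=
  \forall i \near \oo, ~ phi i (x i).

(* b^aLc_{b,h} = |K| *)
Definition baLc_is b h (V : Type) (K : set V) : Prop :=
  least_size [set F | F `<=` slaloms b h /\
    ~ (exists2 x, prodset b x & forall phi, F phi -> evt_avoids phi x)] K.

(* d^aLc_{b,h} = |K| *)
Definition daLc_is b h (V : Type) (K : set V) : Prop :=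
  least_size [set D | D `<=` prodset b /\
    forall phi, slaloms b h phi -> exists2 x, D x & evt_avoids phi x] K.

(* h(i)/|b(i)|, with value 0 when b(i) is infinite *)
Definition h_ratio (R : realType) b h : nat -> R := fun i =>
  if `[< finite_set (b i) >] then (h i)%:R / (#|` fset_set (b i)|)%:R else 0.

Definition Bset b h (N : nat) : set nat := [set i | b i #<= `I_(N * h i)%N].

End AntiLocalization.

(* Main.v *)
Require Import Defs.
From HB Require Import structures.
From mathcomp Require Import all_boot all_order all_algebra.
From mathcomp Require Import finmap.
From mathcomp Require Import all_classical all_reals all_analysis.

Set Implicit Arguments.
Unset Strict Implicit.
Unset Printing Implicit Defensive.

Import Order.TTheory GRing.Theory Num.Theory.
Import numFieldNormedType.Exports.

Local Open Scope classical_set_scope.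
Local Open Scope card_scope.
Local Open Scope ring_scope.


(** For [i] in [B_N] the set [b i] splits into [N] pieces of size at most [h i].
    The [N] slaloms made of the [k]-th pieces cannot be avoided simultaneously,
    while [M < N] slaloms cover at most [M * h i < |b i|] points of [b i] for
    almost all [i]; hence b^aLc = N.

    For d^aLc, a choice of one of the [N] pieces at each [i] in [B_N] is a slalom.
    There are continuum many such choices, indexed by [2^omega], such that any [N]
    of them select all [N] pieces at infinitely many [i].  Thus a single [x]
    avoids fewer than [N] of these slaloms, and a family avoiding all of them has
    size continuum by Koenig's argument.  Conversely, shrinking [b i] to [h i + 1]
    points leaves a product of size at most continuum that avoids every slalom. *)

(** * Injections and cofinite sets of indices *)

Lemma card_le_set_inj {T U : Type} (A : set T) (B : set U) (f : T -> U) :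
  set_fun A B f -> set_inj A f -> A #<= B.
Proof.
move=> fAB /inj_card_eq/card_le_eql <-; apply: subset_card_le.
by move=> _ [x Ax <-]; exact: fAB.
Qed.

Lemma card_le_exists_inj {T U : Type} (u : U) (A : set T) (B : set U) :
  A #<= B -> exists2 f : T -> U, set_fun A B f & set_inj A f.
Proof.
elim/Ppointed: U => U in u B *; first by case: (no u).
by move=> /pcard_leP[f]; exists f; [exact: funS|exact: inj].
Qed.

Lemma finite_setC_near_infty (A : set nat) :
  finite_set (~` A) <-> \forall n \near \oo, A n.
Proof.
split=> [/finite_fsetP[X AX]|[k _ kA]].
  exists (\max_(i <- X) i).+1 => // n /= Xn; apply: contrapT => An.
  have {An} : (~` A) n by [].
  rewrite AX /= => /(@leq_bigmax_seq _ _ xpredT id) /(_ isT).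
  by rewrite leqNgt Xn.
apply: sub_finite_set (finite_II k) => n An /=.
by rewrite ltnNge; apply/negP => kn; apply: An; exact: kA.
Qed.

Lemma infinite_set_near (A P : set nat) :
  infinite_set A -> (\forall n \near \oo, P n) -> exists2 n, A n & P n.
Proof.
move=> Aoo /finite_setC_near_infty /(infinite_setIl Aoo).
by move=> /infinite_setN0[n []]; exists n.
Qed.

Lemma injective_near_infty (u : nat -> nat) (P : set nat) :
  injective u -> (\forall n \near \oo, P n) -> \forall n \near \oo, P (u n).
Proof.
move=> u_inj /finite_setC_near_infty finP; apply/finite_setC_near_infty.
by apply: (@finite_preimage _ _ (~` P) u) => // x y _ _; exact: u_inj.
Qed.

(** Serves to bound a union of [m] sets of size at most [n]: [p] names a set that contains the
    point, [q] its position there. *)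
Lemma card_le_prod_II {T : Type} (A : set T) (p q : T -> nat) (m n : nat) :
  (forall t, A t -> (p t < m)%N /\ (q t < n)%N) ->
  (forall s t, A s -> A t -> p s = p t -> q s = q t -> s = t) ->
  A #<= `I_(m * n).
Proof.
move=> Apq pq_inj; apply: (@card_le_set_inj _ _ _ _ (fun t => p t * n + q t)%N).
  move=> t /Apq[pm qn] /=; rewrite (@leq_trans ((p t).+1 * n)%N)//.
    by rewrite mulSn addnC ltn_add2r.
  by rewrite leq_mul2r pm orbT.
move=> s t /set_mem As /set_mem At e.
have [_ sn] := Apq _ As; have [_ tn] := Apq _ At.
have n0 : (0 < n)%N by case: (n) sn.
apply: pq_inj => //.
  by move/(congr1 (divn^~ n)): e; rewrite !divnMDl// !divn_small// !addn0.
by move/(congr1 (modn^~ n)): e; rewrite !modnMDl !modn_small.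
Qed.

(** * Covering the continuum, and branches of the binary tree *)

(* Koenig: if for every [k] some [y k] differs from the [k]-th section of all the
   [e x k], then the real [z] with sections [y k] is not covered. *)
Lemma continuum_le_countable_cover {T : Type} (D : set T)
    (e : T -> nat -> nat -> bool) :
  (forall y, exists2 x, D x & exists k, e x k = y) -> continuum #<= D.
Proof.
move=> De; apply: contrapT => nD.
pose pr (k : nat) (z : nat -> bool) (m : nat) := z (choice.pickle (k, m)).
have /choice[y yD] k : exists y : nat -> bool, forall x, D x -> pr k (e x k) != y.
  (* Without such a [y], the map from [x] to [pr k (e x k)] would send [D] onto the continuum. *)
  apply: contrapT => ny; apply: nD; apply/pcard_surjP.
  exists (fun x => pr k (e x k)) => y _ /=; apply: contrapT => nyx.
  apply: ny; exists y => x Dx; apply/eqP => exy; apply: nyx; exists x => //.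
pose z n := if choice.unpickle n is Some (k, m) then y k m else false.
have [x Dx [k ez]] := De z; have /eqP := yD k x Dx; apply.
by apply/funext => m; rewrite /pr ez /z choice.pickleK.
Qed.

(* [m] codes a level [n] and a list of nodes of level [n] of the binary tree; the
   value is the position in that list of the node through which [a] passes. *)
Definition branch_index (a : nat -> bool) (m : nat) : nat :=
  if choice.unpickle m is Some (n, s) then index (mkseq a n) (s : seq (seq bool))
  else 0%N.

Lemma mkseq_near_inj (a c : nat -> bool) :
  a <> c -> \forall n \near \oo, mkseq a n <> mkseq c n.
Proof.
move=> ac; have [i /eqP aci] : exists i, a i <> c i.
  apply: contrapT => nac; apply: ac; apply/funext => i.
  by apply: contrapT => aci; apply: nac; exists i.
exists i.+1 => // n /= ni acn; move/eqP: aci; apply.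
by rewrite -(nth_mkseq false a ni) acn nth_mkseq.
Qed.

(** Finitely many distinct branches pass through distinct nodes at every high enough level [n]. The
    code of [n] with the list of these nodes then gives the [k]-th branch index [k]; codes of
    different levels differ, so some such code lies in [P]. *)
Lemma branch_index_independent (s : seq (nat -> bool)) (P : set nat) :
  uniq s -> (\forall m \near \oo, P m) ->
  exists2 m, P m & forall k, (k < size s)%N -> branch_index (nth point s k) m = k.
Proof.
move=> s_uniq Poo.
pose u n := choice.pickle (n, [seq mkseq a n | a <- s]).
have u_inj : injective u by move=> n n' /(pcan_inj choice.pickleK) [].
have : \forall n \near \oo, forall ij : 'I_(size s) * 'I_(size s),
    ij.1 != ij.2 -> mkseq (nth point s ij.1) n <> mkseq (nth point s ij.2) n.
  apply: filter_forall => -[i j] /=; have [->|ij] := eqVneq i j.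
    exact: nearW.
  have sij : nth point s i <> nth point s j.
    move=> /(uniqP point s_uniq); rewrite !inE !ltn_ord => /(_ isT isT) /val_inj.
    exact/eqP.
  by apply: filterS (mkseq_near_inj sij) => n + _.
move=> /(filterI (injective_near_infty u_inj Poo)) /filter_ex [n [Pn sn]].
exists (u n) => // k ks; rewrite /branch_index /u choice.pickleK.
rewrite -[mkseq _ n](nth_map point [::] (fun a : nat -> bool => mkseq a n))//.
rewrite index_uniq ?size_map//.
apply/(uniqP [::]) => i j; rewrite !inE !size_map => si sj.
rewrite !(nth_map point)// => e; apply/eqP; apply: contraPT e => ij.
exact: (sn (Ordinal si, Ordinal sj)).
Qed.

(** * Pieces of [b i] and the value of b^aLc *)

Section AntiLocalizationBounds.
Context {T : choiceType} (b : nat -> set T) (h : nat -> nat)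
  (b_neq0 : forall i, b i !=set0).

(** An injection of [b i] into [I_(N * h i)] is cut into blocks of length [h i]: the quotient by
    [h i] names the piece, the remainder is injective on it. *)
Lemma Bset_pieces (N : nat) : exists P : nat -> nat -> set T,
  [/\ forall i k, P i k `<=` b i,
      forall i k, Bset b h N i -> P i k #<= `I_(h i) &
      forall i t, Bset b h N i -> b i t -> exists2 k, (k < N)%N & P i k t].
Proof.
have /choice[j jP] i : exists f : T -> nat,
    Bset b h N i -> set_fun (b i) `I_(N * h i) f /\ set_inj (b i) f.
  have [Bi|nBi] := pselect (Bset b h N i); last by exists (fun=> 0%N).
  by have [f f1 f2] := card_le_exists_inj 0%N Bi; exists f.
(* The divisor is nonzero because the nonempty [b i] injects into [I_(N * h i)]. *)
have h_gt0 i : Bset b h N i -> (0 < h i)%N.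
  move=> /jP [ji _]; have [t /ji /=] := b_neq0 i.
  by case: (h i) => //; rewrite muln0.
exists (fun i k => [set t | b i t /\ (j i t %/ h i = k)%N]); split.
- by move=> i k t [].
- move=> i k Bi; have hi := h_gt0 _ Bi; have [_ ji] := jP _ Bi.
  apply: (@card_le_set_inj _ _ _ _ (fun t => j i t %% h i)%N).
    by move=> t _ /=; rewrite ltn_mod.
  move=> s t /set_mem[bs sk] /set_mem[bt tk] st; apply: ji; rewrite ?inE//.
  by rewrite (divn_eq (j i s) (h i)) sk -tk st -divn_eq.
- move=> i t Bi bt; exists (j i t %/ h i)%N => //.
  by rewrite ltn_divLR ?h_gt0//; have [/(_ _ bt)] := jP _ Bi.
Qed.

Lemma unavoidable_slaloms (N : nat) : infinite_set (Bset b h N) ->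
  exists F, [/\ F `<=` slaloms b h,
    ~ (exists2 x, prodset b x & forall phi, F phi -> evt_avoids phi x) &
    F #<= `I_N].
Proof.
move=> BN; have [P [Pb Ph Pcover]] := Bset_pieces N.
(* Off [Bset b h N] the size of the pieces is not controlled, so the slalom is made empty there. *)
pose phi k i := [set t | Bset b h N i /\ P i k t].
exists (phi @` `I_N); split; last exact: card_image_le.
  move=> _ [k _ <-] i; split; first by move=> t [_ /Pb].
  have [Bi|nBi] := pselect (Bset b h N i).
    by apply: card_le_trans (Ph _ k Bi); apply: subset_card_le => t [].
  have -> : phi k i = set0 by rewrite -subset0 => t [].
  exact: card_ge0.
move=> [x bx xF].
have : \forall i \near \oo, forall k : 'I_N, ~ phi k i (x i).
  by apply: filter_forall => k; apply: (xF (phi k)); exists (k : nat) => //=.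
move=> /(infinite_set_near BN) [i Bi nphi].
by have [k kN Pk] := Pcover i (x i) Bi (bx i); exact: (nphi (Ordinal kN)).
Qed.

Lemma avoid_few_slaloms (M : nat) (F : set (nat -> set T)) :
  finite_set (Bset b h M) -> F `<=` slaloms b h -> F #<= `I_M ->
  exists2 x, prodset b x & forall phi, F phi -> evt_avoids phi x.
Proof.
move=> BM FS FM.
have [g gM g_inj] := card_le_exists_inj 0%N FM.
have /choice[x xP] i : exists t, b i t /\
    (~ Bset b h M i -> forall phi, F phi -> ~ phi i t).
  apply: contrapT => nx; have [t0 bt0] := b_neq0 i.
  apply: nx; have [Bi|nBi] := pselect (Bset b h M i); first by exists t0.
  apply: contrapT => nx; apply: nBi.
  (* If [F] covers [b i], then [t] is determined by the number of a slalom [c t] containing it and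
     its position in that slalom, which puts [i] in [Bset b h M]. *)
  have /choice[c cP] t : exists phi, b i t -> F phi /\ phi i t.
    apply: contrapT => nt; apply: nx; exists t; split.
      by apply: contrapT => nbt; apply: nt; exists (fun=> set0).
    by move=> _ phi Fphi phit; apply: nt; exists phi.
  have /choice[q qP] phi : exists f : T -> nat, F phi ->
      set_fun (phi i) `I_(h i) f /\ set_inj (phi i) f.
    have [/FS /(_ i) [_ phih]|nF] := pselect (F phi); last by exists (fun=> 0%N).
    by have [f f1 f2] := card_le_exists_inj 0%N phih; exists f.
  apply: (@card_le_prod_II _ _ (g \o c) (fun t => q (c t) t)).
    move=> t /cP[Fc ct]; split; first exact: gM.
    by have [/(_ _ ct)] := qP _ Fc.
  move=> s t /cP[Fs cs] /cP[Ft ct] /= /g_inj; rewrite !inE => /(_ Fs Ft) st.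
  by rewrite st in cs *; have [_] := qP _ Ft; apply; rewrite inE.
exists x => [i|phi Fphi]; first by have [] := xP i.
rewrite -[Bset _ _ _]setCK in BM; move/finite_setC_near_infty : BM.
by apply: filterS => i nBi; have [_] := xP i; exact.
Qed.

Lemma baLc_is_least (N : nat) : infinite_set (Bset b h N) ->
  (forall M, infinite_set (Bset b h M) -> (N <= M)%N) -> baLc_is b h `I_N.
Proof.
move=> BN Nmin.
have lower F : F `<=` slaloms b h /\
    ~ (exists2 x, prodset b x & forall phi, F phi -> evt_avoids phi x) ->
    `I_N #<= F.
  move=> [FS Fx]; have [[M FM]|Foo] := pselect (finite_set F); last first.
    move/infiniteP : Foo; apply: card_le_trans; exact: card_leT.
  rewrite (card_le_eqr FM) card_le_II leqNgt; apply/negP => MN; apply: Fx.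
  apply: (@avoid_few_slaloms M) => //; last by rewrite (card_le_eql FM).
  by apply: contrapT => /Nmin; rewrite leqNgt MN.
split=> //; have [F [FS Fx FN]] := unavoidable_slaloms BN.
by exists F => //; apply: Cantor_Bernstein => //; exact: lower.
Qed.

(** * The value of d^aLc *)

Lemma avoiding_family_le_continuum :
  (\forall i \near \oo, card_lt `I_(h i) (b i)) ->
  exists D, [/\ D `<=` prodset b,
    forall phi, slaloms b h phi -> exists2 x, D x & evt_avoids phi x &
    D #<= continuum].
Proof.
move=> hb.
have [t0 _] := b_neq0 0%N.
have /choice[g gP] i : exists g : nat -> T, card_lt `I_(h i) (b i) ->
    set_fun `I_(h i).+1 (b i) g /\ set_inj `I_(h i).+1 g.
  have [/andP[_ nbh]|nhb] := pselect (card_lt `I_(h i) (b i)); last first.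
    by exists (fun=> t0).
  suff /(card_le_exists_inj t0)[g g1 g2] : `I_(h i).+1 #<= b i by exists g.
  have [[n bn]|boo] := pselect (finite_set (b i)); last first.
    by move/infiniteP : boo; apply: card_le_trans; exact: card_leT.
  move: nbh; rewrite (card_le_eqr bn) (card_le_eql bn) !card_le_II.
  by rewrite -ltnNge.
have /choice[p pP] : forall i, exists t, b i t by exact: b_neq0.
(* The code [0] selects the default point [p i], which serves where [g i] is unspecified;
   intersecting with [prodset b] discards codes that leave [b i]. *)
pose x (y : nat -> nat) i := if y i is k.+1 then g i k else p i.
exists (prodset b `&` range x); split; first by move=> ? [].
- move=> phi phiS.
  have /choice[y yP] i : exists m, b i (if m is k.+1 then g i k else p i) /\
      (card_lt `I_(h i) (b i) -> ~ phi i (if m is k.+1 then g i k else p i)).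
    have [hbi|nhb] := pselect (card_lt `I_(h i) (b i)); last first.
      by exists 0%N; split.
    have [gb g_inj] := gP _ hbi; apply: contrapT => ny.
    (* Pigeonhole: otherwise all [h i + 1] points [g i k] would lie in [phi i]. *)
    have : `I_(h i).+1 #<= `I_(h i).
      have [_] := phiS i; apply: card_le_trans.
      apply: (@card_le_set_inj _ _ _ _ (g i)) => // k kh.
      apply: contrapT => nphi; apply: ny; exists k.+1; split=> //; exact: gb.
    by rewrite card_le_II ltnn.
  exists (x y); first by split; [move=> i; have [] := yP i|exists y].
  by apply: filterS hb => i /(yP i).2.
have /subset_card_le/card_le_trans := @subIsetr _ (prodset b) (range x); apply.
apply: card_le_trans (card_image_le _ _) _.
(* The characteristic function of the graph of [y] embeds the Baire space into [2^omega]. *)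
pose graph (y : nat -> nat) n :=
  if choice.unpickle n is Some (i, k) then y i == k else false.
apply: (@card_le_set_inj _ _ _ _ graph) => // y z _ _ yz; apply/funext => i.
have := congr1 (@^~ (choice.pickle (i, y i))) yz.
by rewrite /graph choice.pickleK eqxx => /esym/eqP.
Qed.

Lemma avoiding_family_ge_continuum (N : nat) (D : set (nat -> T)) :
  infinite_set (Bset b h N) -> D `<=` prodset b ->
  (forall phi, slaloms b h phi -> exists2 x, D x & evt_avoids phi x) ->
  continuum #<= D.
Proof.
move=> BN Db Dphi; have [P [Pb Ph Pcover]] := Bset_pieces N.
have /infiniteP/(card_le_exists_inj 0%N)[e eB e_inj'] := BN.
have e_inj : injective e by move=> m n; apply: e_inj'; rewrite inE.
(* The index may exceed [N]; the size bound of [Bset_pieces] holds for every [k]. *)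
pose phi a i := [set t | exists2 m, e m = i & P i (branch_index a m) t].
have phiS a : slaloms b h (phi a).
  move=> i; split; first by move=> t [m _ /Pb].
  have [[m _ <-]|ni] := pselect (range e i).
    apply: card_le_trans (Ph _ (branch_index a m) (eB m I)).
    by apply: subset_card_le => t [m' /e_inj ->].
  have -> : phi a i = set0.
    by rewrite -subset0 => t [m mi _]; apply: ni; exists m.
  exact: card_ge0.
have finE x : D x -> finite_set [set a | evt_avoids (phi a) x].
  (* Take at least [N] branches whose slaloms [x] avoids. At some late [m] they select all [N]
     pieces of [b (e m)], one of which contains [x (e m)]. *)
  move=> Dx; apply: contrapT => /(@infinite_set_fset _ _ N)[A Ax AN].
  have : \forall m \near \oo, forall k : 'I_(size A),
      ~ phi (nth point A k) (e m) (x (e m)).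
    apply: filter_forall => k.
    apply: (injective_near_infty
      (P := fun i => ~ phi (nth point A k) i (x i)) e_inj).
    by apply: Ax => /=; exact: mem_nth.
  move=> /(branch_index_independent (fset_uniq A)) [m nphi mk].
  have [k kN Pk] := Pcover _ _ (eB m I) (Db _ Dx (e m)).
  have kA := leq_trans kN AN.
  by apply: (nphi (Ordinal kA)); exists m => //=; rewrite mk.
(* [f x] lists, possibly among other values, the branches whose slalom [x] avoids. *)
have /choice[f fP] x : exists f : nat -> nat -> bool,
    D x -> forall a, evt_avoids (phi a) x -> exists k, f k = a.
  have [Dx|nDx] := pselect (D x); last by exists (fun=> point).
  have /finite_set_countable/pcard_surjP[f fsurj] := finE x Dx.
  by exists f => _ a /fsurj[k _ <-]; exists k.
apply: (@continuum_le_countable_cover _ _ f) => a.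
by have [x Dx xa] := Dphi _ (phiS a); exists x => //; exact: fP.
Qed.

(** * From the ratio to the sets [Bset b h N], and the theorem *)

Lemma infinite_Bset (R : realType) :
  ~ (h_ratio R b h i @[i --> \oo] --> (0 : R)) ->
  exists N, infinite_set (Bset b h N).
Proof.
move=> ncvg; apply: contrapT => finB; apply: ncvg.
apply/cvgr0Pnorm_lt => eps eps0.
(* Since [N] exceeds the inverse of [eps], having [N * h i] below the size of a finite [b i] forces
   the ratio below [eps]. *)
pose N := Num.bound eps^-1.
have : finite_set (Bset b h N) by apply: contrapT => ?; apply: finB; exists N.
rewrite -[X in finite_set X]setCK => /finite_setC_near_infty.
apply: filterS => i nBi.
rewrite /h_ratio; case: asboolP => [bi|_]; last by rewrite normr0.
have Nh : (N * h i < #|` fset_set (b i)|)%N.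
  rewrite ltnNge; apply/negP => bN; apply: nBi; case: bi => n bn.
  by rewrite /Bset /= (card_le_eql bn) card_le_II -(card_fset_set bn).
have b0 : 0 < (#|` fset_set (b i)|)%:R :> R by rewrite ltr0n; case: #|` _| Nh.
rewrite ger0_norm ?divr_ge0// ltr_pdivrMr//.
rewrite -ltr_pdivrMl//; apply: le_lt_trans (_ : (N * h i)%:R < _); last by rewrite ltr_nat.
rewrite natrM ler_wpM2r//; apply: ltW; apply: archi_boundP.
by rewrite invr_ge0 ltW.
Qed.

End AntiLocalizationBounds.

Theorem theorem3p2 (R : realType) (T : choiceType)
  (b : nat -> set T) (h : nat -> nat)
  (b_neq0 : forall i, b i !=set0)
  (h_ge1 : \forall i \near \oo, (1 <= h i)%N)
  (h_lt_b : \forall i \near \oo, card_lt `I_(h i) (b i))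
  (ratio_ncvg0 : ~ (h_ratio R b h i @[i --> \oo] --> (0 : R))) :
  (exists N : nat,
    [/\ infinite_set (Bset b h N),
        (forall M : nat, infinite_set (Bset b h M) -> (N <= M)%N) &
        baLc_is b h `I_N]) /\
  daLc_is b h continuum.
Proof.
have exB : exists N, `[< infinite_set (Bset b h N) >].
  by have [N BN] := infinite_Bset ratio_ncvg0; exists N; exact/asboolP.
case: (ex_minnP exB) => N /asboolP BN Nmin'.
have Nmin M : infinite_set (Bset b h M) -> (N <= M)%N by move=> /asboolP/Nmin'.
split; first by exists N; split=> //; exact: baLc_is_least.
have lower D : D `<=` prodset b /\
    (forall phi, slaloms b h phi -> exists2 x, D x & evt_avoids phi x) ->
    continuum #<= D.
  by move=> [Db Dphi]; exact: avoiding_family_ge_continuum BN Db Dphi.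
split=> //; have [D [Db Dphi Dc]] := avoiding_family_le_continuum b_neq0 h_lt_b.
by exists D => //; apply: Cantor_Bernstein => //; exact: lower.
Qed.
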